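(* For all constants $\epsilon,\delta,\gamma\in(0,1)$ there exists a constant $C$ such that for every $N$ there is a set family $\mathcal{S}=\mathcal{S}(\epsilon,\delta,\gamma,N)=(S_i)_{i=1}^{N/2}$ of subsets of $[N]$ with the following properties: (1) for every $x\in\{0,1\}^N$, $\Pr_{S\sim\mathcal{S}}\big[|\overline{x|_S}-\overline{x}|>\epsilon\big]\le\delta$; (2) for all $\eta<(1-\gamma)/2$ and every $x\in\{0,1\}^N$ with $\overline{x}\ge 1-\eta$, $\Pr_{S\sim\mathcal{S}}\big[\overline{x|_S}<\gamma\big]\le\eta/2$; (3) $|S_i|=C=O_{\epsilon,\delta,\gamma}(1)$ for all $i$; (4) the number of sets in $\mathcal{S}$ is $N/2$.
   Context: For $x\in\{0,1\}^N$, $\overline{x}=\frac1N\sum_i x_i$ is the fraction of ones in $x$, and for $S\subseteq[N]$, $\overline{x|_S}$ is the average of $x$ over the positions in $S$. $S\sim\mathcal{S}$ means $S$ is a uniformly random member of the family $\mathcal{S}$.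
   Formalization: Since [N] has no C-element subset when N < C, property (3) is stated as |S_i| = min(C, N), i.e. |S_i| = C for all N ≥ C and S_i = [N] for smaller N; N/2 is read as its integer part for odd N. *)

(* Defs.v *)
From mathcomp Require Import all_boot all_order all_algebra.
From mathcomp Require Import reals.

Set Implicit Arguments.
Unset Strict Implicit.
Unset Printing Implicit Defensive.

Import Order.TTheory GRing.Theory Num.Theory.
Local Open Scope ring_scope.

Definition mean (R : realType) (N : nat) (x : {ffun 'I_N -> bool}) : R :=
  (\sum_(i < N) (x i)%:R) / N%:R.

Definition mean_on (R : realType) (N : nat) (x : {ffun 'I_N -> bool})
    (S : {set 'I_N}) : R :=
  (\sum_(i in S) (x i)%:R) / #|S|%:R.

(* A family is a finite sequence of sets, so a member occurring several times
   is drawn with the corresponding multiplicity.  Equals 0 if the family is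
   empty. *)
Definition family_prob (R : realType) (N : nat) (F : seq {set 'I_N})
    (E : pred {set 'I_N}) : R :=
  (count E F)%:R / (size F)%:R.

(* Main.v *)
(** Draw [N/2] independent uniform [C]-subsets [S] and union-bound over the sets
    [Z] of zeros of [x], with [k = #|Z|].  For (1), Chebyshev bounds the chance
    that one [S] is off by more than [eps] by [1/(eps^2 C)], and a [delta]
    fraction of such [S] is then too unlikely even against [2^N] inputs.  For (2)
    only [k < (1-gamma)N/2] matters, and about [k/4] bad sets are tolerated; the
    [j]-th factorial moment of [#|S :&: Z|] bounds the chance that one [S] is bad
    by [theta^j] with [theta = 3k/(2(1-gamma)N) < 3/4], which for a large constant
    [j] beats the [binom(N,k)] choices of [Z] at every level [k].  The number of
    bad sets is controlled through an exponential potential.  When [N <= C] the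
    full set is taken. *)

Require Import Defs.
From mathcomp Require Import all_boot all_order all_algebra.
From mathcomp Require Import reals lra ring zify.

Set Implicit Arguments.
Unset Strict Implicit.
Unset Printing Implicit Defensive.

Import Order.TTheory GRing.Theory Num.Theory.
Local Open Scope ring_scope.

(** * Factorial moments of the intersection of a [c]-subset with a fixed set *)

(** Complementation maps these sets bijectively onto the subsets of [~: A] with [#|T| - c]
    elements. *)
Lemma card_draws_superset (T : finType) (A : {set T}) (c : nat) :
  (c <= #|T|)%N ->
  #|[set S : {set T} | (A \subset S) && (#|S| == c)]|
  = 'C(#|T| - #|A|, #|T| - c).
Proof.
move=> cT; have -> : (#|T| - #|A|)%N = #|~: A| by rewrite [RHS]cardsCs setCK.
rewrite -cards_draws -(card_imset _ (@setC_inj T)).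
apply: eq_card => B; apply/imsetP/idP => [[S]|].
  rewrite !inE => /andP[AS /eqP cS] ->.
  by rewrite setCS AS cardsCs setCK cS eqxx.
rewrite inE => /andP[BA /eqP cB]; exists (~: B); last by rewrite setCK.
by rewrite inE -setCS setCK BA cardsCs setCK cB subKn ?eqxx.
Qed.

(** Double counting of the pairs of a [c]-set [S] and a [j]-set [A] contained in [S :&: Z]. *)
Lemma sum_bin_setI (T : finType) (Z : {set T}) (c j : nat) :
  (c <= #|T|)%N ->
  (\sum_(S : {set T} | #|S| == c) 'C(#|S :&: Z|, j)
   = 'C(#|Z|, j) * 'C(#|T| - j, #|T| - c))%N.
Proof.
move=> cT.
transitivity (\sum_(S : {set T} | #|S| == c)
   \sum_(A : {set T} | (A \subset Z) && (#|A| == j)) (A \subset S : nat))%N.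
  apply: eq_bigr => S _; rewrite -cards_draws -sum1_card big_mkcond /=.
  rewrite [RHS]big_mkcond /=; apply: eq_bigr => A _.
  by rewrite inE subsetI; case: (A \subset S); case: (A \subset Z); case: eqP.
rewrite exchange_big /= -cards_draws -sum_nat_const.
rewrite [RHS]big_mkcond [LHS]big_mkcond; apply: eq_bigr => A _ /=.
rewrite inE; case: andP => // -[_ /eqP <-].
rewrite -card_draws_superset // -sum1_card big_mkcond [RHS]big_mkcond.
by apply: eq_bigr => S _; rewrite inE; case: (A \subset S); case: eqP.
Qed.

(** The hypergeometric factorial moment, cleared of denominators. The case of [sum_bin_setI] where
    [Z] is the full set serves to eliminate the second binomial. *)
Lemma sum_ffact_setI (T : finType) (Z : {set T}) (c j : nat) :
  (c <= #|T|)%N ->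
  ((\sum_(S : {set T} | #|S| == c) #|S :&: Z| ^_ j) * #|T| ^_ j
   = #|Z| ^_ j * c ^_ j * 'C(#|T|, c))%N.
Proof.
move=> cT.
have := sum_bin_setI [set: T] j cT.
rewrite (eq_bigr (fun=> 'C(c, j))); last by move=> S /eqP; rewrite setIT => ->.
rewrite -big_set sum_nat_const card_draws cardsT => H.
rewrite -(eq_bigr _ (fun S _ => bin_ffact _ j)) -big_distrl /= sum_bin_setI //.
rewrite -!bin_ffact; move/(congr1 (muln ('C(#|Z|, j) * j`! * j`!))): H => H.
transitivity ('C(#|Z|, j) * j`! * j`! *
  ('C(#|T|, j) * 'C(#|T| - j, #|T| - c)))%N; last rewrite -H.
  by ring.
by ring.
Qed.

(** * Choosing a family by an exponential potential *)

(* The weights of the remaining potential are updated after each draw, so the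
   method of conditional expectations becomes an induction on [M]. *)
Lemma greedy_family (R : realFieldType) (T I : finType) (O : {set T}) (M : nat)
    (B : I -> pred T) (lam q w : I -> R) :
  (forall i, 0 <= q i) -> (forall i, 0 <= lam i) -> (forall i, 0 <= w i) ->
  (0 < #|O|)%N ->
  (forall i, lam i * #|[set S in O | B i S]|%:R <= (q i - 1) * #|O|%:R) ->
  \sum_i w i * q i ^+ M < 1 ->
  exists F : seq T, [/\ size F = M, {subset F <= O} &
    forall i, w i * lam i ^+ count (B i) F < 1].
Proof.
move=> q0 l0 + O0 hB.
(* For a boolean exponent [b], [lam ^+ b <= 1 + lam * b]; so [q] bounds the average growth factor of
   a weight in one draw. *)
have hq i : \sum_(S in O) lam i ^+ B i S <= q i * #|O|%:R.
  apply: (@le_trans _ _ (\sum_(S in O) (1 + lam i * (B i S)%:R))).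
    apply: ler_sum => S _; case: (B i S); rewrite ?mulr1 ?mulr0 ?addr0 //.
    by rewrite expr1 lerDr.
  rewrite big_split /= -mulr_sumr -natr_sum sumr_const -big_mkcondr /=.
  by have := hB i; rewrite -sum1_card big_set; lra.
elim: M w => [|M IH] w w0 hw.
  exists [::]; split=> // i; apply: le_lt_trans hw.
  rewrite (bigD1 i) //= !expr0 lerDl sumr_ge0 // => k _.
  by rewrite expr0 mulr1.
(* If every draw left the potential at 1 or more, so would the average draw, against [hq] and
   [hw]. *)
have [S SO hS] : exists2 S, S \in O &
    \sum_i (w i * lam i ^+ B i S) * q i ^+ M < 1.
  apply/exists_inP; apply: contraT => /exists_inPn h.
  suff : #|O|%:R * 1 <= #|O|%:R * \sum_i w i * q i ^+ M.+1.
    by rewrite ler_pM2l ?ltr0n // leNgt hw.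
  rewrite mulr1 -[leLHS]sumr_const.
  apply: (@le_trans _ _
    (\sum_(S in O) \sum_i (w i * lam i ^+ B i S) * q i ^+ M)).
    by apply: ler_sum => S /h; rewrite -leNgt.
  rewrite exchange_big /= mulr_sumr; apply: ler_sum => i _.
  rewrite -mulr_suml -mulr_sumr.
  have -> : #|O|%:R * (w i * q i ^+ M.+1) = w i * (q i * #|O|%:R) * q i ^+ M.
    by rewrite exprS; ring.
  by rewrite ler_wpM2r ?exprn_ge0 // ler_wpM2l.
have [|F [sF FO hF]] := IH (fun i => w i * lam i ^+ B i S) _ hS.
  by move=> i; rewrite mulr_ge0 // exprn_ge0.
exists (S :: F); split; first by rewrite /= sF.
  by move=> A; rewrite inE => /predU1P[->//|/FO].
by move=> i /=; rewrite exprD mulrA; exact: hF.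
Qed.

(** * Elementary bounds on powers, binomials and falling factorials *)

Lemma Bernoulli (R : realFieldType) (x : R) (n : nat) : -1 <= x ->
  1 + n%:R * x <= (1 + x) ^+ n.
Proof.
move=> x1; elim: n => [|n IH]; first by rewrite mul0r addr0.
rewrite exprS; apply: (@le_trans _ _ ((1 + x) * (1 + n%:R * x))).
  have : 0 <= n%:R * (x * x) by rewrite mulr_ge0 // -expr2 sqr_ge0.
  by rewrite -natr1; nra.
by apply: ler_wpM2l => //; lra.
Qed.

Lemma exp_succ_inv_le4 (R : realFieldType) (n : nat) :
  (0 < n)%N -> (1 + n%:R^-1) ^+ n <= 4 :> R.
Proof.
move=> n0; have n0' : 0 < n%:R :> R by rewrite ltr0n.
have ni : 0 < n%:R^-1 :> R by rewrite invr_gt0.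
have n1 : 0 < n%:R + 1 :> R by lra.
(* By Bernoulli, [(n / (n + 1)) ^ ceil (n / 2)] is at least [1 / 2]. *)
pose y : R := - (n%:R + 1)^-1.
have y1 : 1 + y = (1 + n%:R^-1)^-1 by rewrite /y; field; rewrite !lt0r_neq0.
have y0 : -1 <= y by rewrite /y lerN2 invf_le1 //; lra.
have hB : 2^-1 <= (1 + y) ^+ uphalf n.
  apply: le_trans (Bernoulli (uphalf n) y0).
  have : (uphalf n)%:R * (n%:R + 1)^-1 <= 2^-1 :> R.
    rewrite ler_pdivrMr // ler_pdivlMl // natr1 -natrM ler_nat; lia.
  rewrite /y mulrN; lra.
have y1' : 0 < 1 + y <= 1.
  by rewrite y1 invr_gt0 invf_le1; lra.
suff : 4^-1 <= (1 + y) ^+ n.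
  rewrite y1 exprVn lef_pV2 // posrE ?exprn_gt0 //.
  by rewrite addr_gt0 // invr_gt0.
(* Squaring [hB] gives [1 / 4]; rounding the exponent up from [n] only lowers the power, as the base
   is at most 1. *)
apply: (@le_trans _ _ ((1 + y) ^+ (uphalf n * 2))).
  rewrite exprM; apply: (@le_trans _ _ (2^-1 ^+ 2)); first by rewrite expr2; lra.
  by rewrite lerXn2r // nnegrE ?exprn_ge0 //; lra.
by apply: ler_wiXn2l; [lra|lra|lia].
Qed.

(** Bernoulli gives [1 + k / n <= (1 + 1 / n) ^ k], which reduces the claim to [k = 1]. *)
Lemma exp_ratio_le4 (R : realFieldType) (n k : nat) :
  (0 < n)%N -> (1 + k%:R / n%:R) ^+ n <= 4 ^+ k :> R.
Proof.
move=> n0; have n0' : 0 < n%:R^-1 :> R by rewrite invr_gt0 ltr0n.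
apply: (@le_trans _ _ (((1 + n%:R^-1) ^+ k) ^+ n)).
  rewrite lerXn2r // ?nnegrE ?exprn_ge0 ?Bernoulli //; try lra.
  by rewrite addr_ge0 // mulr_ge0 // ltW.
rewrite exprAC lerXn2r // ?nnegrE ?exprn_ge0 ?exp_succ_inv_le4 //; lra.
Qed.

(** The left side is a single term of the binomial expansion of [(1 + k / n) ^ n]. *)
Lemma bin_ratio_le4 (R : realFieldType) (n k : nat) : (k <= n)%N -> (0 < n)%N ->
  'C(n, k)%:R * (k%:R / n%:R) ^+ k <= 4 ^+ k :> R.
Proof.
move=> kn n0; apply: le_trans (exp_ratio_le4 R k n0).
have h0 : 0 <= k%:R / n%:R :> R by rewrite divr_ge0.
rewrite exprDn (bigD1 (Ordinal (kn : (k < n.+1)%N))) //= expr1n mul1r.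
rewrite -[X in _ <= X + _]mulr_natl lerDl sumr_ge0 // => i _.
by rewrite expr1n mul1r mulrn_wge0 // exprn_ge0.
Qed.

(** Factor by factor, [(k - i) / (n - i) <= k / n] for [i < k]; at [i = k] the left side
    vanishes. *)
Lemma ffact_ratio_le (R : realFieldType) (n k j : nat) : (k <= n)%N -> (0 < n)%N ->
  (k ^_ j)%:R <= (k%:R / n%:R) ^+ j * (n ^_ j)%:R :> R.
Proof.
move=> kn n0; have n0' : 0 < n%:R :> R by rewrite ltr0n.
elim: j => [|j IH]; first by rewrite !ffactn0 expr0 mul1r.
rewrite !ffactnSr !natrM exprSr mulrACA; apply: ler_pM => //.
have [kj|jk] := leqP k j.
  by rewrite (eqP kj) mulr_ge0 // divr_ge0.
rewrite mulrAC ler_pdivlMr // -!natrM ler_nat mulnBl mulnBr leq_sub2l //.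
by rewrite mulnC leq_mul.
Qed.

Lemma ffact_ge_exp (n j : nat) : ((n - j) ^ j <= n ^_ j)%N.
Proof.
elim: j => [|j IH]; first by rewrite expn0 ffactn0.
rewrite ffactnSr expnSr leq_mul ?leq_sub2l //.
by apply: leq_trans IH; case: j => // j; rewrite leq_exp2r // leq_sub2l.
Qed.

Lemma ffact_le_exp (n j : nat) : (n ^_ j <= n ^ j)%N.
Proof.
elim: j => [|j IH]; first by rewrite expn0 ffactn0.
by rewrite ffactnSr expnSr leq_mul // leq_subr.
Qed.

(** * Tail bounds for one uniform [c]-subset *)

Lemma sum_ffact_setI_le (R : realFieldType) (T : finType) (Z : {set T})
    (c j : nat) : (c <= #|T|)%N -> (j <= #|T|)%N -> (0 < #|T|)%N ->
  \sum_(S : {set T} | #|S| == c) (#|S :&: Z| ^_ j)%:R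
  <= (#|Z|%:R / #|T|%:R * c%:R) ^+ j * 'C(#|T|, c)%:R :> R.
Proof.
move=> cT jT T0.
have nT : 0 < (#|T| ^_ j)%:R :> R by rewrite ltr0n ffact_gt0.
rewrite -natr_sum -(ler_pM2r nT) -natrM sum_ffact_setI // !natrM.
rewrite [leRHS]mulrAC ler_wpM2r // exprMn [leRHS]mulrAC ler_pM //.
  by rewrite ffact_ratio_le // max_card.
by rewrite -natrX ler_nat ffact_le_exp.
Qed.

Lemma draws_deviation (R : realFieldType) (T : finType) (Z : {set T}) (c : nat)
    (eps : R) : (0 < c <= #|T|)%N -> (1 < #|T|)%N -> 0 < eps ->
  eps ^+ 2 * c%:R * #|[set S : {set T} | (#|S| == c) &&
      (eps < `|#|Z|%:R / #|T|%:R - #|S :&: Z|%:R / c%:R|)]|%:R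
  <= 'C(#|T|, c)%:R.
Proof.
move=> /andP[c0 cT] T1 e0; have T0 : (0 < #|T|)%N by apply: ltnW.
have c0' : 0 < c%:R :> R by rewrite ltr0n.
have T0' : 0 < #|T|%:R :> R by rewrite ltr0n.
set u := #|Z|%:R / #|T|%:R.
have u0 : 0 <= u by rewrite divr_ge0.
have u1 : u <= 1 by rewrite ler_pdivrMr // mul1r ler_nat max_card.
have E2 := sum_ffact_setI_le R Z cT T1 T0.
have E1 : \sum_(S : {set T} | #|S| == c) #|S :&: Z|%:R
    = u * c%:R * 'C(#|T|, c)%:R :> R.
  apply: (mulIf (lt0r_neq0 T0')).
  have := congr1 (fun n => n%:R : R) (sum_ffact_setI Z 1 cT).
  rewrite !ffactn1 !natrM natr_sum => E.
  under eq_bigr do rewrite -[#|_ :&: _|]ffactn1.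
  by rewrite E /u; field; rewrite lt0r_neq0.
(* The second factorial moment is at most [(u * c) ^+ 2], the square of the mean, so the variance is
   at most [u * c <= c]. *)
have V : \sum_(S : {set T} | #|S| == c) (#|S :&: Z|%:R - u * c%:R) ^+ 2
    <= c%:R * 'C(#|T|, c)%:R.
  under eq_bigr => S _.
    rewrite (_ : _ ^+ 2 = (#|S :&: Z| ^_ 2)%:R
      + (1 - 2 * (u * c%:R)) * #|S :&: Z|%:R + (u * c%:R) ^+ 2); last first.
      rewrite ffactnSr ffactn1; case: #|_ :&: _| => [|m]; first by ring.
      by rewrite subn1 natrM -natr1; ring.
    over.
  rewrite !big_split /= -mulr_sumr E1 -[\sum_(S | _) (u * _) ^+ 2]big_set.
  rewrite sumr_const card_draws -[X in _ + X <= _]mulr_natl.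
  have := @ler_wpM2r _ 'C(#|T|, c)%:R (ler0n _ _) _ _
    (ler_wpM2r (ler0n R c) u1).
  by move: E2; rewrite -/u mul1r; nra.
rewrite -(ler_pM2l c0'); apply: le_trans V.
rewrite -sum1_card natr_sum mulrA mulr_sumr big_set big_mkcondr /=.
apply: ler_sum => S _; case: ifPn => [h|_]; last by rewrite sqr_ge0.
have -> : #|S :&: Z|%:R - u * c%:R = - (c%:R * (u - #|S :&: Z|%:R / c%:R)).
  by field; rewrite lt0r_neq0.
rewrite sqrrN exprMn mulr1 mulrCA -expr2 mulrC.
rewrite ler_wpM2l ?sqr_ge0 // -(real_normK (num_real (u - _))).
by rewrite lerXn2r ?nnegrE // ltW.
Qed.

(** Markov's inequality for the [j]-th falling factorial. As [j] is at most a third of [s * c], a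
    counted [S] has [#|S :&: Z| ^_ j] at least [(2 / 3 * s * c) ^ j]. *)
Lemma draws_upper_tail (R : realFieldType) (T : finType) (Z : {set T})
    (c j : nat) (s : R) :
  (0 < c <= #|T|)%N -> 0 < s <= 1 -> 3 * j%:R <= s * c%:R ->
  #|[set S : {set T} | (#|S| == c) && (s * c%:R < #|S :&: Z|%:R)]|%:R
  <= (3 / (2 * s) * (#|Z|%:R / #|T|%:R)) ^+ j * 'C(#|T|, c)%:R.
Proof.
move=> /andP[c0 cT] /andP[s0 s1] hj.
have c0' : 0 < c%:R :> R by rewrite ltr0n.
have jT : (j <= #|T|)%N.
  apply: leq_trans cT; rewrite -(ler_nat R); have := ler0n R j; nra.
have D0 : 0 < 2 / 3 * s * c%:R by rewrite !mulr_gt0 // invr_gt0.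
rewrite -(ler_pM2l (exprn_gt0 j D0)) [leRHS]mulrA -exprMn.
rewrite (_ : 2 / 3 * s * c%:R * _ = #|Z|%:R / #|T|%:R * c%:R); last first.
  by field; rewrite !lt0r_neq0 ?ltr0n // (leq_trans c0).
apply: le_trans (sum_ffact_setI_le R Z cT jT (leq_trans c0 cT)).
rewrite -sum1_card natr_sum mulr_sumr big_set big_mkcondr /=.
apply: ler_sum => S _; case: ifPn => [h|_]; last by rewrite ler0n.
rewrite mulr1; apply: le_trans (_ : ((#|S :&: Z| - j) ^ j)%:R <= _); last first.
  by rewrite ler_nat ffact_ge_exp.
have jS : (j <= #|S :&: Z|)%N.
  by rewrite -(ler_nat R); have := ler0n R j; lra.
by rewrite natrX lerXn2r ?nnegrE ?(ltW D0) // natrB //; lra.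
Qed.

(** * Summing the potential over levels [k = #|Z|] *)

Lemma sum_set_card (R : pzRingType) (T : finType) (f : nat -> R) :
  \sum_(Z : {set T}) f #|Z| = \sum_(k < #|T|.+1) 'C(#|T|, k)%:R * f k.
Proof.
rewrite (partition_big (fun Z : {set T} => inord #|Z| : 'I_#|T|.+1) predT) //=.
apply: eq_bigr => k _.
have Ek (Z : {set T}) : (inord #|Z| == k) = (#|Z| == k :> nat).
  by rewrite -val_eqE /= inordK // ltnS max_card.
rewrite (eq_bigl _ _ Ek) (eq_bigr (fun=> f k)); last by move=> Z /eqP ->.
by rewrite -big_set sumr_const card_draws mulr_natl.
Qed.

Lemma sum_geo4 (R : realFieldType) (n : nat) :
  \sum_(k < n) 4 ^- k.+1 <= 2^-1 :> R.
Proof.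
suff -> : \sum_(k < n) 4 ^- k.+1 = (1 - 4 ^- n) / 3 :> R.
  have : 0 <= 4 ^- n :> R by rewrite invr_ge0 exprn_ge0.
  lra.
elim: n => [|n IH]; first by rewrite big_ord0 expr0; lra.
by rewrite big_ord_recr /= IH exprS invfM; lra.
Qed.

(** Put [u = k / n] and [t = beta * u]. Then [(1 + t) ^+ m] costs at most [4 ^+ (b * k)],
    [t ^+ l.+1] is at most [(3 / 4) ^+ l * b * u], and [u ^+ k] cancels the binomial up to [4 ^+ k].
    The hypothesis on [l] absorbs these constants and leaves [4 ^- k]. *)
Lemma level_weight_le (R : realFieldType) (n k m l b : nat) (beta : R) :
  (0 < k <= n)%N -> (m <= n)%N -> 0 < beta <= b%:R ->
  beta * (k%:R / n%:R) <= 3 / 4 -> (3 / 4) ^+ l * b%:R * 4 ^+ b.+2 <= 1 :> R ->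
  'C(n, k)%:R * ((beta * (k%:R / n%:R)) ^+ (l.+1 * k)
     * (1 + beta * (k%:R / n%:R)) ^+ m) <= 4 ^- k.
Proof.
move=> /andP[k0 kn] mn /andP[b0 bb] ht hl; have n0 := leq_trans k0 kn.
set u := k%:R / n%:R in ht *; set t := beta * u in ht *.
have u0 : 0 <= u by rewrite divr_ge0.
have t0 : 0 <= t by rewrite mulr_ge0 // ltW.
have h1 : (1 + t) ^+ m <= (4 ^+ b) ^+ k.
  rewrite -exprM; apply: le_trans (exp_ratio_le4 R (b * k) n0).
  apply: (@le_trans _ _ ((1 + t) ^+ n)); first by rewrite ler_weXn2l ?lerDl.
  have tb : t <= b%:R * u by rewrite ler_wpM2r.
  by rewrite natrM -mulrA -/u lerXn2r ?nnegrE //; lra.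
have h2 : t ^+ (l.+1 * k) <= ((3 / 4) ^+ l * b%:R) ^+ k * u ^+ k.
  have tu : t ^+ l.+1 <= (3 / 4) ^+ l * b%:R * u.
    rewrite exprSr -mulrA ler_pM ?exprn_ge0 //; last by rewrite ler_wpM2r.
    by rewrite lerXn2r ?nnegrE //; lra.
  have t1 : 0 <= t ^+ l.+1 by rewrite exprn_ge0.
  by rewrite exprM -exprMn lerXn2r ?nnegrE //; lra.
apply: (@le_trans _ _ ('C(n, k)%:R * u ^+ k *
   (((3 / 4) ^+ l * b%:R) ^+ k * (4 ^+ b) ^+ k))).
  rewrite -mulrA ler_wpM2l //.
  rewrite [leRHS](_ : _ = ((3 / 4) ^+ l * b%:R) ^+ k * u ^+ k * (4 ^+ b) ^+ k).
    by rewrite ler_pM ?exprn_ge0 //; lra.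
  by ring.
apply: (@le_trans _ _ (4 ^+ k * (((3 / 4) ^+ l * b%:R) ^+ k * (4 ^+ b) ^+ k))).
  rewrite ler_wpM2r ?bin_ratio_le4 //.
  by rewrite mulr_ge0 // !exprn_ge0 // mulr_ge0 // exprn_ge0 //; lra.
have p0 : 0 <= (3 / 4) ^+ l * b%:R * 4 ^+ b :> R.
  by rewrite !mulr_ge0 // exprn_ge0 //; lra.
rewrite -exprMn -exprMn -exprVn lerXn2r ?nnegrE //; move: hl;
  rewrite !exprS; lra.
Qed.

(** * The family, in terms of zero sets *)

Lemma half_bounds (n : nat) : (1 < n)%N ->
  [/\ (0 < n./2)%N, (n./2 <= n)%N & (n <= 3 * n./2)%N].
Proof. by move=> n1; split; lia. Qed.

(** Here [s] stands for [1 - gamma] and [d] for a bound on [1 / delta]. The potential is tuned so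
    that one violated constraint would already make its own term at least 1. *)
Lemma sampler_family (R : realFieldType) (eps s : R) (d l b c N : nat) :
  0 < eps -> 0 < s <= 1 -> 3 / (2 * s) <= b%:R ->
  (3 / 4) ^+ l * b%:R * 4 ^+ b.+2 <= 1 :> R ->
  3 * (6 * l.+1).+1%:R <= s * c%:R -> 64 ^+ d <= eps ^+ 2 * c%:R ->
  (1 < c <= N)%N ->
  exists F : seq {set 'I_N}, [/\ size F = N./2,
    forall S, S \in F -> #|S| = c,
    forall Z : {set 'I_N}, (d * count (fun S : {set 'I_N} =>
      (eps < `|#|Z|%:R / N%:R - #|S :&: Z|%:R / c%:R|)%R) F < N./2)%N &
    forall Z : {set 'I_N}, (0 < #|Z|)%N -> #|Z|%:R / N%:R < s / 2 ->
      (6 * count (fun S : {set 'I_N} => (s * c%:R < #|S :&: Z|%:R)%R) F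
       < #|Z|)%N].
Proof.
move=> e0 s01 hb hl hj hd /andP[c1 cN].
have c0N : (0 < c <= #|'I_N|)%N by rewrite card_ord cN andbT ltnW.
have N1 : (1 < #|'I_N|)%N by rewrite card_ord (leq_trans c1 cN).
have s0 : 0 < s by case/andP: s01.
set beta := 3 / (2 * s) in hb; have b0 : 0 < beta by rewrite divr_gt0 ?mulr_gt0.
pose t (Z : {set 'I_N}) : R := beta * (#|Z|%:R / N%:R).
have t0 Z : 0 <= t Z by apply: mulr_ge0; [exact: ltW|exact: divr_ge0].
pose M := N./2; have [M0 MN N3M] := half_bounds (leq_trans c1 cN).
(* The summand [inl Z] carries the accuracy property (1) and [inr Z] the tail
   property (2), for the inputs [x] whose set of zeros is [Z]. *)
pose I := ({set 'I_N} + {set 'I_N})%type.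
pose B (i : I) (S : {set 'I_N}) := match i with
  | inl Z => eps < `|#|Z|%:R / N%:R - #|S :&: Z|%:R / c%:R|
  | inr Z => s * c%:R < #|S :&: Z|%:R end.
(* Against the tail bound with exponent [(6 * l.+1).+1], this [lam] leaves one factor [t Z], which
   is [q - 1]. *)
pose lam (i : I) : R := match i with
  | inl _ => 64 ^+ d | inr Z => t Z ^- (6 * l.+1) end.
pose q (i : I) : R := match i with inl _ => 2 | inr Z => 1 + t Z end.
(* Weight 0 drops the tail constraint for empty or large [Z]. Otherwise weight and [lam] balance
   when six times the number of bad sets reaches [#|Z|]. *)
pose w (i : I) : R := match i with
  | inl _ => 64 ^- M
  | inr Z => if (0 < #|Z|)%N && (#|Z|%:R / N%:R < s / 2)
             then t Z ^+ (l.+1 * #|Z|) else 0 end.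
pose O := [set S : {set 'I_N} | #|S| == c].
have cO : #|O| = 'C(N, c) by rewrite card_draws card_ord.
have [||||||F [sF FO hF]] := @greedy_family R _ _ O M B lam q w.
- by case=> Z //=; rewrite addr_ge0.
- by case=> Z /=; rewrite ?invr_ge0 exprn_ge0.
- case=> Z /=; first by rewrite invr_ge0 exprn_ge0.
  by case: ifP => // _; rewrite exprn_ge0.
- by rewrite cO bin_gt0.
- move=> i; rewrite cO (_ : [set S in O | B i S] =
     [set S : {set 'I_N} | (#|S| == c) && B i S]); last first.
    by apply/setP => S; rewrite !inE.
  case: i => Z /=.
    have := draws_deviation Z c0N N1 e0; rewrite card_ord => h.
    rewrite (_ : 2 - 1 = 1) ?mul1r; last by ring.
    by apply: le_trans h; rewrite ler_wpM2r.
  have := draws_upper_tail Z c0N s01 hj; rewrite card_ord -/(t Z) => h.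
  rewrite [X in _ <= X * _](_ : _ = t Z); last by ring.
  apply: (@le_trans _ _
    (t Z ^- (6 * l.+1) * (t Z ^+ (6 * l.+1).+1 * 'C(N, c)%:R))).
    by rewrite ler_wpM2l // invr_ge0 exprn_ge0.
  rewrite mulrA ler_wpM2r // exprSr mulrA.
  (* The powers do not cancel when [t Z = 0], that is, for empty [Z]. *)
  have [->|nz] := eqVneq (t Z) 0; first by rewrite !mulr0.
  by rewrite mulVf ?mul1r // expf_neq0.
- rewrite big_sumType /= sumr_const -cardsT -powersetT card_powerset cardsT card_ord.
  (* As [N <= 3 * M], at most [2 ^ (3 * M)] terms occur, so the choice of 64 leaves [4 ^- M]. *)
  have h1 : (64 ^- M * 2 ^+ M) *+ (2 ^ N) <= 4^-1 :> R.
    rewrite -mulr_natr natrX.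
    apply: (@le_trans _ _ (64 ^- M * 2 ^+ M * 2 ^+ (3 * M))).
      apply: ler_wpM2l; first by rewrite mulr_ge0 ?invr_ge0 ?exprn_ge0.
      by apply: ler_weXn2l => //; rewrite ler1n.
    rewrite exprM -exprVn -!exprMn.
    have -> : 64^-1 * 2 * 2 ^+ 3 = 4^-1 :> R by field.
    by rewrite -[leRHS]expr1 ler_wiXn2l //; lra.
  have h2 : \sum_Z w (inr Z) * q (inr Z) ^+ M <= 2^-1.
    (* The level bound [4 ^- k] is shared evenly among the sets of size [k]. *)
    pose f k : R := if (0 < k)%N then 4 ^- k / 'C(N, k)%:R else 0.
    apply: (@le_trans _ _ (\sum_(Z : {set 'I_N}) f #|Z|)).
      apply: ler_sum => Z _ /=; rewrite /f.
      have kN : (#|Z| <= N)%N by rewrite -[leqRHS]card_ord max_card.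
      case: (ltnP 0 #|Z|) => k0 /=; last by rewrite mul0r.
      case: ifPn => hk; last by rewrite mul0r divr_ge0 // invr_ge0 exprn_ge0.
      rewrite ler_pdivlMr ?ltr0n ?bin_gt0 // mulrC.
      apply: (level_weight_le (b := b)) => //; first by rewrite k0.
      - by rewrite b0.
      (* The density threshold [s / 2] is where [t Z] reaches [3 / 4]. *)
      have -> : 3 / 4 = beta * (s / 2) by rewrite /beta; field; rewrite lt0r_neq0.
      by rewrite ler_wpM2l // ltW.
    rewrite sum_set_card card_ord big_ord_recl /= {1}/f mulr0 add0r.
    apply: le_trans (sum_geo4 R N); apply: ler_sum => k _.
    rewrite /f /= mulrCA divff ?mulr1 // pnatr_eq0 -lt0n bin_gt0.
    exact: ltn_ord.
  by apply: le_lt_trans (lerD h1 h2) _; lra.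
exists F; split=> //.
- by move=> S /FO; rewrite inE => /eqP.
- move=> Z; have /= := hF (inl Z); rewrite -exprM ltr_pdivrMl ?exprn_gt0 //.
  by rewrite mulr1 ltr_eXn2l //; lra.
- move=> Z Z0 hZ; have /= := hF (inr Z); rewrite Z0 hZ /=.
  have tp : 0 < t Z.
    apply: mulr_gt0 => //; apply: divr_gt0; rewrite ltr0n //.
    exact: leq_trans (ltnW c1) cN.
  have t1 : t Z <= 1.
    have /ltW : beta * (#|Z|%:R / N%:R) < beta * (s / 2) by rewrite ltr_pM2l.
    have -> : beta * (s / 2) = 3 / 4 by rewrite /beta; field; rewrite lt0r_neq0.
    by rewrite /t; lra.
  rewrite exprVn -exprM ltr_pdivrMr ?exprn_gt0 // mul1r => h.
  rewrite ltnNge; apply/negP => k6; move: h; rewrite ltNge => /negP; apply.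
  by apply: ler_wiXn2l => //; rewrite mulnC mulnAC leq_mul.
Qed.

(** * Translation from zero sets to means, and the theorem *)

Lemma mean_setT (R : realType) (N : nat) (x : {ffun 'I_N -> bool}) :
  mean R x = mean_on R x setT.
Proof.
rewrite /mean /mean_on cardsT card_ord; congr (_ / _).
by apply: eq_bigl => i; rewrite inE.
Qed.

Lemma mean_onE (R : realType) (N : nat) (x : {ffun 'I_N -> bool})
    (S : {set 'I_N}) : (0 < #|S|)%N ->
  mean_on R x S = 1 - #|S :&: [set i | ~~ x i]|%:R / #|S|%:R.
Proof.
move=> S0; have nz : #|S|%:R != 0 :> R by rewrite pnatr_eq0 -lt0n.
apply: (mulIf nz); rewrite mulrBl !divfK // mul1r; apply/eqP.
rewrite eq_sym subr_eq -natr_sum -natrD eqr_nat -!sum1_card.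
rewrite [X in (_ == _ + X)%N](eq_bigl (fun i => (i \in S) && ~~ x i)); last first.
  by move=> i; rewrite !inE.
rewrite [X in (_ == _ + X)%N]big_mkcondr -big_split /=; apply/eqP.
by apply: eq_bigr => i _; case: (x i).
Qed.

Lemma meanE (R : realType) (N : nat) (x : {ffun 'I_N -> bool}) : (0 < N)%N ->
  mean R x = 1 - #|[set i | ~~ x i]|%:R / N%:R.
Proof.
by move=> N0; rewrite mean_setT mean_onE cardsT card_ord // setTI.
Qed.

Lemma mean_le1 (R : realType) (N : nat) (x : {ffun 'I_N -> bool}) :
  mean R x <= 1.
Proof.
(* For [N = 0] the mean is 0, by the convention for division by zero. *)
case: N x => [|N] x; first by rewrite /mean big_ord0 mul0r.
by rewrite meanE // gerBl divr_ge0.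
Qed.

(** The size is [minn C N] since an [N]-set with [N < C] has no subset of size [C]; [N / 2] is
    rounded down. *)
Theorem theorem4 (R : realType) (eps delta gamma : R)
    (heps : 0 < eps < 1) (hdelta : 0 < delta < 1) (hgamma : 0 < gamma < 1) :
  exists C : nat, forall N : nat, exists F : seq {set 'I_N},
    [/\ (forall x : {ffun 'I_N -> bool},
           family_prob R F (fun S => `|mean_on R x S - mean R x| > eps)
             <= delta),
        (forall (eta : R) (x : {ffun 'I_N -> bool}),
           eta < (1 - gamma) / 2 -> mean R x >= 1 - eta ->
           family_prob R F (fun S => mean_on R x S < gamma) <= eta / 2),
        (forall S : {set 'I_N}, S \in F -> #|S| = minn C N)
      & size F = N./2].
Proof.
case/andP: heps => e0 _; case/andP: hdelta => d0 _; case/andP: hgamma => g0 g1.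
pose s := 1 - gamma; have s0 : 0 < s by rewrite /s; lra.
have nat_above (a : R) : exists n : nat, a <= n%:R.
  by exists (Num.trunc a).+1; rewrite ltW // truncnS_gt.
have [d hd] := nat_above delta^-1.
have [b hb] := nat_above (3 / (2 * s)).
(* Bernoulli makes [(4 / 3) ^+ l] at least [l / 3], so a large [l] beats any constant depending on
   [b]. *)
have [l hl] : exists l : nat, (3 / 4) ^+ l * b%:R * 4 ^+ b.+2 <= 1 :> R.
  have [l hl] := nat_above (3 * (b%:R * 4 ^+ b.+2)); exists l.
  have h : b%:R * 4 ^+ b.+2 <= (4 / 3) ^+ l :> R.
    have := @Bernoulli R 3^-1 l.
    rewrite (_ : 1 + 3^-1 = 4 / 3 :> R) //; last by field.
    by move=> H; apply: le_trans (H _); lra.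
  rewrite -mulrA -(invf_div 4 3) exprVn mulrC ler_pdivrMr ?mul1r //.
  by rewrite exprn_gt0 // divr_gt0.
have [c1 hc1] := nat_above (3 * (6 * l.+1).+1%:R / s).
have [c2 hc2] := nat_above (64 ^+ d / eps ^+ 2).
have [C [C1 cC1 cC2]] : exists C : nat,
    [/\ (1 < C)%N, c1%:R <= C%:R :> R & c2%:R <= C%:R :> R].
  exists (c1 + c2 + 2)%N; rewrite !ler_nat addn2; split=> //.
    by rewrite -!addnS leq_addr.
  by rewrite -!addSn leq_addl.
exists C => N; have [NC|CN] := leqP N C.
  have cnt0 P : ~~ P setT -> count P (nseq N./2 [set: 'I_N]) = 0%N.
    by move=> /negbTE nP; rewrite count_nseq nP mul0n.
  exists (nseq N./2 setT); split.
  - move=> x; rewrite /family_prob cnt0 ?mul0r ?ltW //.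
    by rewrite -mean_setT subrr normr0 -leNgt ltW.
  (* A mean is at most 1, which forces [eta >= 0]; and [1 - eta > gamma], so the full set is never
     bad. *)
  - move=> eta x h1 h2; have h3 := mean_le1 R x.
    rewrite /family_prob cnt0 ?mul0r; first by lra.
    by rewrite -mean_setT -leNgt; lra.
  - by move=> S /nseqP[-> _]; rewrite cardsT card_ord.
  - by rewrite size_nseq.
have [||||F [sF FC hF1 hF2]] :=
  @sampler_family R eps s d l b C N e0 _ hb hl.
- by rewrite s0 /s; lra.
- by rewrite [leRHS]mulrC -ler_pdivrMr // (le_trans hc1).
- by rewrite [leRHS]mulrC -ler_pdivrMr ?exprn_gt0 // (le_trans hc2).
- by rewrite (ltnW CN) C1.
have N1 : (1 < N)%N by apply: ltn_trans CN.
have N0 : (0 < N)%N by apply: ltnW.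
have N0' : 0 < N%:R :> R by rewrite ltr0n.
have M0 : 0 < (N./2)%:R :> R by rewrite ltr0n half_gt0.
have C0n := ltnW C1; have C0 : 0 < C%:R :> R by rewrite ltr0n.
exists F; split=> //.
- move=> x; rewrite /family_prob sF ler_pdivrMr //.
  rewrite (@eq_in_count _ _ (fun S : {set 'I_N} => eps <
      `|#|[set i | ~~ x i]|%:R / N%:R
        - #|S :&: [set i | ~~ x i]|%:R / C%:R|)); last first.
    move=> S /FC SC; rewrite meanE // mean_onE SC //; congr (_ < `|_|); ring.
  move: (hF1 [set i | ~~ x i]); move: (count _ F) => n h.
  have dn : d%:R * n%:R <= (N./2)%:R :> R by rewrite -natrM ler_nat ltnW.
  have : 1 <= delta * d%:R.
    by rewrite mulrC -ler_pdivrMr // mul1r.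
  move=> dd; apply: (@le_trans _ _ (delta * (d%:R * n%:R))).
    by rewrite mulrA ler_peMl.
  by rewrite ler_pM2l.
- move=> eta x h1 h2; rewrite /family_prob sF.
  rewrite (@eq_in_count _ _ (fun S : {set 'I_N} =>
      s * C%:R < #|S :&: [set i | ~~ x i]|%:R)); last first.
    move=> S /FC SC; rewrite mean_onE SC // ltrBlDl -ltrBlDr.
    by rewrite ltr_pdivlMr.
  move: h2; rewrite meanE //; set Z := [set i | ~~ x i] => h2.
  have hZe : #|Z|%:R / N%:R <= eta by lra.
  have hZ : #|Z|%:R / N%:R < s / 2 by rewrite /s; lra.
  (* Without zeros no set is bad; the strict bound [hF2] covers only nonempty [Z]. *)
  have [/eqP|Z0] := posnP #|Z|.
    rewrite cards_eq0 => /eqP Z0; rewrite (@eq_count _ _ pred0) ?count_pred0.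
      by move: h2; rewrite Z0 cards0 mul0r mul0r; lra.
    move=> S /=; rewrite Z0 setI0 cards0; apply/negbTE.
    by rewrite -leNgt mulr_ge0 // ltW.
  have := hF2 Z Z0 hZ; move: (count _ F) => n h.
  apply: (@le_trans _ _ (#|Z|%:R / N%:R / 2)); last first.
    by rewrite ler_pM2r // invr_gt0.
  rewrite ler_pdivrMr //.
  have -> : #|Z|%:R / N%:R / 2 * (N./2)%:R
      = #|Z|%:R * (N./2)%:R / (2 * N)%:R :> R.
    by rewrite natrM; field; rewrite lt0r_neq0.
  rewrite ler_pdivlMr ?ltr0n ?muln_gt0 // -!natrM ler_nat.
  (* The factor 6 is 2 times 3: since [N <= 3 * N./2] even for odd [N], [n * (2 * N)] is at most
     [6 * n * N./2]. *)
  apply: leq_trans (leq_mul (ltnW h) (leqnn N./2)).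
  have [_ _ N3] := half_bounds N1.
  rewrite (mulnC 6%N) -mulnA leq_mul2l; apply/orP; right.
  by move: N3; clear; lia.
Qed.
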